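(* Consider a facility-based system $(N,M,(A^i)_{i\in N},P)$ with $N=\{1,\dots,n\}$, $M=\{1,\dots,m\}$, and set of profiles $A=\prod_{i=1}^nA^i=\{S_1,\dots,S_\ell\}$, $\ell=|A|$. A set of facility-cost functions $(\Xi_j)_{j\in M}$ can be found such that the facility-based system becomes a congestion game with $P$ as its potential function if and only if the linear system $$B\,\Xi^{\mathrm{T}}=\mathbf{P},\qquad B=\begin{bmatrix}B(S_1)\\ B(S_2)\\ \vdots\\ B(S_\ell)\end{bmatrix},\quad \mathbf{P}=\begin{bmatrix}P(S_1)\\ P(S_2)\\ \vdots\\ P(S_\ell)\end{bmatrix},$$ in the unknown row vector $\Xi\in\mathbb{R}^{mn}$ has at least one solution.
   Context: A facility-based system (FBS) is a tuple $(N,M,(A^i)_{i\in N},P)$, where $N=\{1,\dots,n\}$ is the set of players, $M=\{1,\dots,m\}$ is the set of facilities shared by the players, $A^i\subset 2^M$ is the strategy set of player $i$ (each strategy is a subset of $M$), $A:=\prod_{i=1}^nA^i$ is the set of profiles, and $P:A\to\mathbb{R}$ is the system performance criterion (overall cost). For $a=(a^1,\dots,a^n)\in A$, $r_j(a):=|\{i:j\in a^i\}|$ is the number of users of facility $j$. Given facility-cost functions (FCFs) $\Xi_j:\mathbb{R}\to\mathbb{R}$, $j\in M$ (evaluated at numbers of users $1,\dots,n$), the associated congestion game $(N,M,(A^i),(\Xi_j))$ has payoff functions $c_i(a)=\sum_{j\in a^i}\Xi_j(r_j(a))$ and potential function $$a\mapsto\sum_{j\in\bigcup_{i=1}^n a^i}\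 \sum_{k=1}^{r_j(a)}\Xi_j(k).$$ ''The FBS becomes a congestion game with $P$ as its potential function'' means that, with these FCFs, this potential function equals $P$ on $A$. For $j\in M$, $b_j(a)\in\mathbb{R}^n$ is the row vector whose first $r_j(a)$ entries are $1$ and remaining $n-r_j(a)$ entries are $0$, and $B(a):=[b_1(a),\dots,b_m(a)]\in\mathbb{R}^{mn}$ (a row vector). The vector $\Xi=[\Xi_1,\dots,\Xi_m]\in\mathbb{R}^{mn}$ collects the row vectors $\Xi_j=[\Xi_j(1),\dots,\Xi_j(n)]$. *)

(* Defs.v *)
From HB Require Import structures.
From mathcomp Require Import all_boot all_order all_algebra.
From mathcomp Require Import reals.

Set Implicit Arguments.
Unset Strict Implicit.
Unset Printing Implicit Defensive.

Import Order.TTheory GRing.Theory Num.Theory.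
Local Open Scope ring_scope.

(* Players and facilities are 'I_n and 'I_m, so players, facilities and vector
   entries are numbered from 0; numbers of users are not shifted. *)

(* The product of the strategy sets, as a finite type. *)
Definition profile (n m : nat) (A : 'I_n -> {set {set 'I_m}}) : finType :=
  {a : {ffun 'I_n -> {set 'I_m}} | a \in family A}.

Record fbs (R : realType) (n m : nat) := FBS {
  strategies : 'I_n -> {set {set 'I_m}};
  performance : profile strategies -> R }.

(* Facility-cost functions are defined on all of R, but are only ever evaluated
   at numbers of users 1, ..., n. *)
Record congestionGame (R : realType) (n m : nat) := CongestionGame {
  game_strategies : 'I_n -> {set {set 'I_m}};
  facility_cost : 'I_m -> R -> R }.

Section Profiles.
Variables (R : realType) (n m : nat) (A : 'I_n -> {set {set 'I_m}}).
Implicit Types (a : profile A) (j : 'I_m).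

Definition users a j : nat := #|[set i : 'I_n | j \in val a i]|.

(* Column k stands for the number of users k.+1, hence the first (users a j)
   entries are 1. *)
Definition usage_row a j : 'rV[R]_n := \row_(k < n) (k < users a j)%N%:R.

(* mxvec is row-major, so this is the concatenation of the rows b_j. *)
Definition usage_vector a : 'rV[R]_(m * n) :=
  mxvec (\matrix_(j < m) usage_row a j).

Definition usage_matrix (l : nat) (S : 'I_l -> profile A) : 'M[R]_(l, m * n) :=
  \matrix_(s < l) usage_vector (S s).

End Profiles.

Section Game.
Variables (R : realType) (n m : nat) (G : congestionGame R n m).
Implicit Types (a : profile (game_strategies G)) (i : 'I_n).

Definition payoff i a : R :=
  \sum_(j in val a i) facility_cost G j (users a j)%:R.

Definition potential a : R :=
  \sum_(j in \bigcup_(i < n) val a i)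
    \sum_(1 <= k < (users a j).+1) facility_cost G j k%:R.

Lemma potentialE a : potential a =
  \sum_(j < m) \sum_(1 <= k < (users a j).+1) facility_cost G j k%:R.
Proof.
rewrite /potential [RHS](bigID (mem (\bigcup_(i < n) val a i))) /=.
rewrite [X in _ = _ + X]big1 ?addr0 // => j /bigcupP nj.
suff -> : users a j = 0%N by rewrite big_geq.
apply/eqP; rewrite cards_eq0; apply/eqP/setP => i; rewrite !inE.
by apply/negP => ji; apply: nj; exists i.
Qed.

(* The potential is an exact potential for the payoffs. *)
Lemma potential_exact i a a' :
    (forall i', i' != i -> val a i' = val a' i') ->
  payoff i a - payoff i a' = potential a - potential a'.
Proof.
move=> aa'.
pose others (b : profile (game_strategies G)) (j : 'I_m) := #|[set i' : 'I_n | (i' != i) && (j \in val b i')]|.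
have usersE (b : profile (game_strategies G)) j :
    users b j = ((j \in val b i) + others b j)%N.
  rewrite /users (cardsD1 i) inE; congr (_ + _)%N.
  by apply: eq_card => i'; rewrite !inE.
have othersE j : others a j = others a' j.
  apply: eq_card => i'; rewrite !inE.
  by case: eqVneq => //= /aa' ->.
have step (b : profile (game_strategies G)) : potential b = payoff i b +
    \sum_(j < m) \sum_(1 <= k < (others b j).+1) facility_cost G j k%:R.
  rewrite potentialE /payoff [X in _ = X + _]big_mkcond -big_split /=; apply: eq_bigr => j _.
  rewrite usersE; case: (j \in _); last by rewrite add0n add0r.
  by rewrite add1n big_nat_recr //= addrC.
rewrite !step; under [in X in _ = X - _]eq_bigr do rewrite othersE.
by rewrite opprD addrACA subrr addr0.
Qed.

End Game.

Section System.
Variables (R : realType) (n m : nat) (F : fbs R n m).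

Definition associated_game (Xi : 'I_m -> R -> R) : congestionGame R n m :=
  CongestionGame (strategies F) Xi.

Definition becomes_congestion_game (Xi : 'I_m -> R -> R) : Prop :=
  forall a : profile (strategies F),
    potential (G := associated_game Xi) a = performance a.

Definition performance_column (l : nat) (S : 'I_l -> profile (strategies F)) :
  'cV[R]_l := \col_(s < l) performance (S s).

End System.

(* Main.v *)
Require Import Defs.
From mathcomp Require Import all_boot all_order all_algebra.
From mathcomp Require Import reals.

(** A facility with [r] users contributes [Xi_j 1 + ... + Xi_j r] to the
    potential, which is the dot product of the row [b_j] of [r] ones with the
    row of values of [Xi_j] at [1, ..., n].  Hence the potential at a profile is
    the product of its usage vector with the vector of all these values
    ([usage_matrix_cost]), and the linear system says that the potential agrees
    with the performance at each enumerated profile, that is, at every profile.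
    This matches cost functions that solve the problem with the solutions that
    are vectors of cost values.  Every vector is one of those, since the natural
    numbers [1, ..., n] are distinct reals, at which values can be prescribed
    independently ([cost_values_surj]). *)

Set Implicit Arguments.
Unset Strict Implicit.
Unset Printing Implicit Defensive.

Import GRing.Theory Num.Theory.
Local Open Scope ring_scope.

Lemma mxvec_dot (R : pzRingType) (m n : nat) (A B : 'M[R]_(m, n)) :
  (mxvec A *m (mxvec B)^T) 0 0 = \sum_(i < m) \sum_(j < n) A i j * B i j.
Proof.
rewrite mxE pair_big /= (reindex _ (curry_mxvec_bij m n)) /=.
by apply: eq_bigr => -[i j] _; rewrite mxE !mxvecE.
Qed.

Lemma users_le (n m : nat) (A : 'I_n -> {set {set 'I_m}}) (a : profile A) j :
  (users a j <= n)%N.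
Proof. by rewrite -[X in (_ <= X)%N](card_ord n) max_card. Qed.

(** Column [k] holds the cost for [k.+1] users, in accordance with
    [usage_row]. *)
Definition cost_values (R : realType) (n m : nat) (Xi : 'I_m -> R -> R) :
  'rV[R]_(m * n) := mxvec (\matrix_(j < m, k < n) Xi j k.+1%:R).

Lemma cost_values_surj (R : realType) (n m : nat) (v : 'rV[R]_(m * n)) :
  exists Xi : 'I_m -> R -> R, cost_values n Xi = v.
Proof.
exists (fun j x => \sum_(k < n | x == k.+1%:R) vec_mx v j k).
rewrite -[RHS]vec_mxK; congr mxvec; apply/matrixP => j k; rewrite mxE.
(* Characteristic zero leaves only the term of index k. *)
by rewrite (big_pred1 k) // => k'; rewrite eqr_nat eqSS eq_sym.
Qed.

Lemma usage_vector_cost (R : realType) (n m : nat) (G : congestionGame R n m)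
    (a : profile (game_strategies G)) :
  (usage_vector R a *m (cost_values n (facility_cost G))^T) 0 0 = potential a.
Proof.
rewrite mxvec_dot potentialE; apply: eq_bigr => j _.
rewrite big_add1 /= big_mkord.
rewrite (big_ord_widen n (fun k => facility_cost G j k.+1%:R) (users_le a j)).
rewrite [RHS]big_mkcond; apply: eq_bigr => k _; rewrite !mxE.
by case: ifP; rewrite (mul1r, mul0r).
Qed.

Lemma usage_matrix_cost (R : realType) (n m : nat) (G : congestionGame R n m)
    (l : nat) (S : 'I_l -> profile (game_strategies G)) :
  usage_matrix R S *m (cost_values n (facility_cost G))^T =
  \col_(s < l) potential (S s).
Proof.
apply/colP => s; rewrite [RHS]mxE -usage_vector_cost [LHS]mxE [RHS]mxE.
by apply: eq_bigr => k _; rewrite [usage_matrix _ _ _ _]mxE.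
Qed.

(** Surjectivity of the enumeration turns the row-by-row equations into equality
    of potential and performance on the whole set of profiles. *)
Lemma becomes_congestion_gameP (R : realType) (n m : nat) (F : fbs R n m)
    (l : nat) (S : 'I_l -> profile (strategies F)) (Xi : 'I_m -> R -> R) :
    bijective S ->
  becomes_congestion_game F Xi <->
  usage_matrix R S *m (cost_values n Xi)^T = performance_column S.
Proof.
case=> rank _ rankK; rewrite (usage_matrix_cost (G := associated_game F Xi) S).
split=> [potE | /colP potE a]; first by apply/colP => s; rewrite !mxE potE.
by have := potE (rank a); rewrite !mxE rankK.
Qed.

Theorem mainTheorem3 (R : realType) (n m : nat) (F : fbs R n m)
    (l : nat) (S : 'I_l -> profile (strategies F)) (hS : bijective S) :
  (exists Xi : 'I_m -> R -> R, becomes_congestion_game F Xi) <->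
  (exists Xi : 'rV[R]_(m * n),
     usage_matrix R S *m Xi^T = performance_column S).
Proof.
split=> [[Xi /(becomes_congestion_gameP Xi hS) XiP] | [v]].
  by exists (cost_values n Xi).
have [Xi <-] := cost_values_surj v.
by move/(becomes_congestion_gameP Xi hS); exists Xi.
Qed.
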